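(* Let $n=4$ and $$Q = \begin{pmatrix} 8 & -14 & 0 & 0\\ -14 & 25 & -25 & 0\\ 0 & -25 & 25 & -14\\ 0 & 0 & -14 & 8\end{pmatrix},\qquad c = \begin{pmatrix}12\\29\\0\\0\end{pmatrix}.$$ Then the problem $\min\{x^TQx+c^Tx : x\in[0,1]^4\}$ has optimal value $0$, attained uniquely at $x=0$, while the relaxation $$\min\left\{ Q\bullet X + c^Tx \;:\; X \le xe^T,\ \begin{pmatrix}1 & x^T\\ x & X\end{pmatrix}\succeq 0\right\}$$ has optimal value at most $-109/1024$. In particular, the relaxation gap (the difference between the two optimal values) is positive.
   Context: The SDP variables are $x\in\mathbb{R}^4$ and $X$ a symmetric real $4\times 4$ matrix. $e$ is the all-ones vector, $A\bullet B = \mathrm{trace}(A^TB)$, $\succeq 0$ means positive semidefinite, and $X\le xe^T$ is entrywise, i.e. $X_{ij}\le x_i$ for all $i,j$. *)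

(* Defs.v *)
From HB Require Import structures.
From mathcomp Require Import all_boot all_order all_algebra.
From mathcomp Require Import classical_sets reals.

Set Implicit Arguments.
Unset Strict Implicit.
Unset Printing Implicit Defensive.

Import Order.TTheory GRing.Theory Num.Theory.

Local Open Scope classical_set_scope.
Local Open Scope ring_scope.

Section Minimization.
Variables (R : realType) (T : Type).

Definition minimizer (F : set T) (f : T -> R) (x : T) : Prop :=
  F x /\ forall y, F y -> f x <= f y.

(* Being the optimal value of a [min] problem includes being attained. *)
Definition optimal_value (F : set T) (f : T -> R) (v : R) : Prop :=
  exists2 x, minimizer F f x & f x = v.

End Minimization.

Section BoxQP.
Variables (R : realType) (n : nat).

Definition psd (m : nat) (A : 'M[R]_m) : Prop :=
  A^T = A /\ forall v : 'cV[R]_m, 0 <= (v^T *m A *m v) 0 0.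

Definition mxdot (A B : 'M[R]_n) : R := \tr (A^T *m B).

Definition unit_box : set 'cV[R]_n :=
  [set x | forall i, 0 <= x i 0 <= 1].

Definition qp_obj (Q : 'M[R]_n) (c x : 'cV[R]_n) : R :=
  (x^T *m Q *m x) 0 0 + (c^T *m x) 0 0.

Definition sdp_feasible : set ('cV[R]_n * 'M[R]_n) :=
  [set z | let: (x, X) := z in
    [/\ X^T = X,
        forall i j, X i j <= (x *m (const_mx 1 : 'cV[R]_n)^T) i j
      & psd (block_mx (1%:M : 'M[R]_1) x^T x X)]].

Definition sdp_obj (Q : 'M[R]_n) (c : 'cV[R]_n) (z : 'cV[R]_n * 'M[R]_n) : R :=
  mxdot Q z.2 + (c^T *m z.1) 0 0.

End BoxQP.

Arguments unit_box {R n}.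
Arguments sdp_feasible {R n}.

Definition Q4 (R : realType) : 'M[R]_4 :=
  \matrix_(i, j) nth 0 (nth [::]
    [:: [::   8; -14;   0;   0];
        [:: -14;  25; -25;   0];
        [::   0; -25;  25; -14];
        [::   0;   0; -14;   8]] i) j.

Definition c4 (R : realType) : 'cV[R]_4 :=
  \col_i nth 0 [:: 12; 29; 0; 0] i.

(* Main.v *)
(** On the box, minimizing the quadratic program over the outer variables x1 and
x4 is explicit, and a case split at x2 = 3/7 and x3 = 4/7 turns positivity into
sums of squares. For the relaxation, X_ii <= x_i and positive semidefiniteness
force all entries of a feasible (x, X) into [-1, 1], so the feasible set is
compact and the minimum is attained; a rational feasible point, obtained by
rounding a numerical optimum (about -0.12206), has value -57/512 < -109/1024. *)
Require Import Defs.
From mathcomp Require Import all_boot all_order all_algebra ring lra.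
From mathcomp Require Import boolp classical_sets reals.
From mathcomp Require Import topology normedtype derive.

Set Implicit Arguments.
Unset Strict Implicit.
Unset Printing Implicit Defensive.

Import Order.TTheory GRing.Theory Num.Theory.
Import numFieldTopology.Exports numFieldNormedType.Exports.

Local Open Scope classical_set_scope.
Local Open Scope ring_scope.

(** * Continuity of matrix entries, and closed sets cut out by inequalities *)

Section Continuity.
Variables (R : realType) (T : topologicalType).

Lemma continuous_add (f g : T -> R) :
  continuous f -> continuous g -> continuous (fun t => f t + g t).
Proof. by move=> cf cg t; apply: cvgD; [exact: cf|exact: cg]. Qed.

Lemma continuous_sub (f g : T -> R) :
  continuous f -> continuous g -> continuous (fun t => f t - g t).
Proof. by move=> cf cg t; apply: cvgB; [exact: cf|exact: cg]. Qed.

Lemma continuous_sum (I : Type) (r : seq I) (f : I -> T -> R) :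
  (forall i, continuous (f i)) -> continuous (fun t => \sum_(i <- r) f i t).
Proof.
move=> cf; elim: r => [|i r IHr] t.
  by under eq_fun do rewrite big_nil; exact: cvg_cst.
by under eq_fun do rewrite big_cons; apply: cvgD; [exact: cf|exact: IHr].
Qed.

Lemma continuous_mulmx_entry m n p (A : T -> 'M[R]_(m, n))
    (B : T -> 'M[R]_(n, p)) :
  (forall i j, continuous (fun t => A t i j)) ->
  (forall i j, continuous (fun t => B t i j)) ->
  forall i j, continuous (fun t => (A t *m B t) i j).
Proof.
move=> cA cB i j; under eq_fun do rewrite mxE.
by apply: continuous_sum => k t; apply: cvgM; [exact: cA|exact: cB].
Qed.

Lemma closed_nonneg (f : T -> R) : continuous f -> closed [set t | 0 <= f t].
Proof.
by move=> cf; apply: (@preimage_closed _ _ f [set x | 0 <= x]) => [t _|];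
  [exact: cf|exact: closed_ge].
Qed.

Lemma closed_forall (I : Type) (P : I -> T -> Prop) :
  (forall i, closed [set t | P i t]) -> closed [set t | forall i, P i t].
Proof.
move=> cP; rewrite (_ : [set t | _] = \bigcap_(i in setT) [set t | P i t]).
  by apply: closed_bigI => i _; exact: cP.
by apply/seteqP; split=> t /= Pt i; [move=> _; exact: Pt|exact: (Pt i Logic.I)].
Qed.

End Continuity.

(** * Entry bounds for positive semidefinite matrices *)

Section Psd.
Variables (R : realType) (m : nat) (A : 'M[R]_m).
Hypothesis psdA : psd A.

Lemma psd_diag_ge0 i : 0 <= A i i.
Proof.
have := psdA.2 (delta_mx i 0).
by rewrite trmx_delta -rowE -colE !mxE.
Qed.

(** The form is nonnegative at [e_i + e_j] and at [e_i - e_j]; the two signs together bound the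
    absolute value. *)
Lemma psd_entry_bound i j : `|A i j| *+ 2 <= A i i + A j j.
Proof.
have symA k l : A k l = A l k by rewrite -[in LHS]psdA.1 mxE.
pose u (s : R) : 'cV[R]_m := delta_mx i 0 + s *: delta_mx j 0.
have quad s : ((u s)^T *m A *m u s) 0 0
    = A i i + s * A i j *+ 2 + s ^+ 2 * A j j.
  have -> : (u s)^T = delta_mx 0 i + s *: delta_mx 0 j.
    by rewrite linearD linearZ /= !trmx_delta.
  rewrite /u !mulmxDl !mulmxDr -!scalemxAl -!scalemxAr -!rowE -!colE.
  rewrite !mxE (symA j i); ring.
have := psdA.2 (u 1).
have := psdA.2 (u (-1)).
rewrite !quad => h1 h2.
suff : `|A i j| <= (A i i + A j j) / 2 by lra.
by rewrite ler_norml; apply/andP; split; lra.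
Qed.

End Psd.

(** * Compactness of the feasible set and attainment in the relaxation *)

Section SDP.
Variables (R : realType) (n : nat) (Q : 'M[R]_n) (c : 'cV[R]_n).

(** Symmetry of the block matrix follows from that of [X]. Feasibility thus becomes a family of
    scalar conditions, each closed in [(x, X)]. *)
Lemma sdp_feasibleP (x : 'cV[R]_n) (X : 'M[R]_n) :
  sdp_feasible (x, X) <->
  [/\ forall i j, X i j = X j i,
      forall i j, X i j <= x i 0
    & forall v : 'cV[R]_(1 + n),
        0 <= (v^T *m block_mx (1%:M : 'M[R]_1) x^T x X *m v) 0 0].
Proof.
have E i j : (x *m (const_mx 1 : 'cV[R]_n)^T) i j = x i 0.
  by rewrite !mxE big_ord1 !mxE mulr1.
split=> [[sX lX [_ pX]]|[sX lX pX]].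
  by split=> // i j; [rewrite -[in LHS]sX mxE|rewrite -(E i j)].
have sX' : X^T = X by apply/matrixP => i j; rewrite mxE.
split=> //; first by move=> i j; rewrite E.
by split=> //; rewrite tr_block_mx tr_scalar_mx trmxK sX'.
Qed.

Lemma sdp_feasible_bound (x : 'cV[R]_n) (X : 'M[R]_n) : sdp_feasible (x, X) ->
  (forall i, 0 <= x i 0 <= 1) /\ (forall i j, `|X i j| <= 1).
Proof.
move=> [_ lX pX].
have Xx i : X i i <= x i 0.
  by have := lX i i; rewrite !mxE big_ord1 !mxE mulr1.
have dX i : 0 <= X i i.
  by have := psd_diag_ge0 pX (rshift 1 i); rewrite block_mxEdr.
have xb i : 0 <= x i 0 <= 1.
  (* Pairing index [i] with the corner entry 1 gives [2 |x_i| <= X_ii + 1 <= x_i + 1]. *)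
  have := psd_entry_bound pX (rshift 1 i) (lshift n 0).
  rewrite block_mxEdr block_mxEdl block_mxEul !mxE /= => h.
  have := ler_norm (x i 0); have := Xx i; have := dX i.
  by move: h => /= *; apply/andP; split; lra.
split=> // i j.
have := psd_entry_bound pX (rshift 1 i) (rshift 1 j); rewrite !block_mxEdr.
have := Xx i; have := Xx j; have /andP[_] := xb i; have /andP[_] := xb j.
lra.
Qed.

(* Compactness of boxes is only available for row vectors. *)
Definition decode (w : 'rV[R]_(n + n * n)) : 'cV[R]_n * 'M[R]_n :=
  ((lsubmx w)^T, vec_mx (rsubmx w)).

Lemma decode_surj z : exists w, decode w = z.
Proof.
by case: z => x X; exists (row_mx x^T (mxvec X));
  rewrite /decode row_mxKl row_mxKr trmxK mxvecK.
Qed.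

Lemma decode_continuous1 i j : continuous (fun w => (decode w).1 i j).
Proof.
move=> w; under eq_fun do rewrite !mxE.
exact: coord_continuous.
Qed.

Lemma decode_continuous2 i j : continuous (fun w => (decode w).2 i j).
Proof.
move=> w; under eq_fun do rewrite !mxE.
exact: coord_continuous.
Qed.

Lemma continuous_decode_block i j : continuous (fun w =>
  block_mx (1%:M : 'M[R]_1) (decode w).1^T (decode w).1 (decode w).2 i j).
Proof.
case: (split_ordP i) => i' ->; case: (split_ordP j) => j' ->.
- under eq_fun do rewrite block_mxEul; exact: cst_continuous.
- under eq_fun do rewrite block_mxEur mxE; exact: decode_continuous1.
- under eq_fun do rewrite block_mxEdl; exact: decode_continuous1.
- under eq_fun do rewrite block_mxEdr; exact: decode_continuous2.
Qed.

Lemma closed_feasible : closed [set w | sdp_feasible (decode w)].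
Proof.
(* Symmetry is put as [0 <= X_ij - X_ji] for all [i], [j]: exchanging the indices recovers
   equality. *)
rewrite (_ : mkset _ =
   [set w | forall i j, 0 <= (decode w).2 i j - (decode w).2 j i] `&`
   [set w | forall i j, 0 <= (decode w).1 i 0 - (decode w).2 i j] `&`
   [set w | forall v : 'cV[R]_(1 + n), 0 <= (v^T *m
      block_mx (1%:M : 'M[R]_1) (decode w).1^T (decode w).1 (decode w).2
      *m v) 0 0]).
  apply: closedI; [apply: closedI|].
  - do 2![apply: closed_forall => ?]; apply: closed_nonneg.
    by apply: continuous_sub; exact: decode_continuous2.
  - do 2![apply: closed_forall => ?]; apply: closed_nonneg.
    by apply: continuous_sub; [exact: decode_continuous1|exact: decode_continuous2].
  - apply: closed_forall => v; apply: closed_nonneg.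
    apply: continuous_mulmx_entry; last by move=> *; exact: cst_continuous.
    apply: continuous_mulmx_entry; first by move=> *; exact: cst_continuous.
    exact: continuous_decode_block.
apply/seteqP; split=> w /=.
  move/sdp_feasibleP => [sX lX pX]; split=> //; split=> i j.
    by rewrite sX subrr.
  by rewrite subr_ge0.
move=> [[sX lX] pX]; apply/sdp_feasibleP; split=> // i j.
  by apply: le_anti; apply/andP; split; rewrite -subr_ge0; exact: sX.
by rewrite -subr_ge0.
Qed.

Lemma compact_feasible : compact [set w | sdp_feasible (decode w)].
Proof.
have box := @rV_compact R (n + n * n) (fun=> [set` `[(-1 : R), 1]])
  (fun=> @segment_compact R (-1) 1).
apply: subclosed_compact closed_feasible box _ => w /= /sdp_feasible_bound[xb Xb] k.
rewrite in_itv /= -ler_norml.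
case: (split_ordP k) => [i ->|l ->].
  by have := xb i; rewrite !mxE => /andP[x0 x1]; rewrite ger0_norm.
case/mxvec_indexP: l => i j.
by have := Xb i j; rewrite !mxE.
Qed.

Lemma continuous_sdp_obj : continuous (fun w => sdp_obj Q c (decode w)).
Proof.
apply: continuous_add.
  apply: continuous_sum => i; apply: continuous_mulmx_entry => *.
    exact: cst_continuous.
  exact: decode_continuous2.
apply: continuous_mulmx_entry => *; first exact: cst_continuous.
exact: decode_continuous1.
Qed.

(** At the origin the block form is the square of the first coordinate. This gives the nonemptiness
    that the extreme value theorem requires. *)
Lemma sdp_feasible0 : sdp_feasible (0 : 'cV[R]_n, 0 : 'M[R]_n).
Proof.
apply/sdp_feasibleP; split=> [i j|i j|v]; [by rewrite !mxE|by rewrite !mxE|].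
rewrite -[v]vsubmxK tr_col_mx mul_row_block mul_row_col.
rewrite trmx0 !mulmx0 !addr0 mul0mx addr0 mulmx1 mxE big_ord1 !mxE.
exact: sqr_ge0.
Qed.

Lemma sdp_attained : exists v, optimal_value sdp_feasible (sdp_obj Q c) v.
Proof.
have [w0 w0E] := decode_surj (0, 0).
have ne : [set w | sdp_feasible (decode w)] !=set0.
  by exists w0; rewrite /mkset w0E; exact: sdp_feasible0.
have [w wF wmin] := compact_EVT_min ne compact_feasible
  (continuous_subspaceT continuous_sdp_obj).
exists (sdp_obj Q c (decode w)), (decode w) => //; split.
  by move: wF; rewrite inE.
(* Every pair has a code, so a minimum over codes is a minimum over all feasible pairs. *)
move=> z; have [w' <-] := decode_surj z => zF.
by apply: wmin; rewrite inE.
Qed.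

End SDP.

(** * Positivity of the quadratic program on the box *)

Definition qp_poly (R : realType) (a b c d : R) : R :=
  8 * a ^+ 2 - 28 * a * b + 25 * (b - c) ^+ 2 - 28 * c * d + 8 * d ^+ 2
  + 12 * a + 29 * b.

Section QpPoly.
Variables (R : realType) (a b c d : R).
Hypotheses (a01 : 0 <= a <= 1) (b01 : 0 <= b <= 1).
Hypotheses (c01 : 0 <= c <= 1) (d01 : 0 <= d <= 1).

Lemma qp_poly_ge_squares : b <= 3 / 7 -> c <= 4 / 7 ->
  4 * a ^+ 2 + b ^+ 2 + c ^+ 2 / 4 + 8 * (d - 7 / 4 * c) ^+ 2
    <= qp_poly a b c d.
Proof.
rewrite /qp_poly => hb hc.
have /andP[a0 _] := a01; have /andP[b0 _] := b01.
(* The thresholds come from [12a - 28ab = 28a(3/7 - b)] and [29b - 50bc = 50b(4/7 - c) + 3b/7]. *)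
have ab : 0 <= a * (3 / 7 - b) by apply: mulr_ge0; lra.
have bc : 0 <= b * (4 / 7 - c) by apply: mulr_ge0; lra.
have := sqr_ge0 a; have := sqr_ge0 b; have := sqr_ge0 c.
lra.
Qed.

Lemma qp_poly_gt0 : ~~ ((b <= 3 / 7) && (c <= 4 / 7)) -> 0 < qp_poly a b c d.
Proof.
rewrite /qp_poly.
have /andP[a0 a1] := a01; have /andP[b0 b1] := b01.
have /andP[c0 c1] := c01; have /andP[d0 d1] := d01.
(* The minimizer 7c/4 in d leaves [0, 1] when c > 4/7: d = 1 is then optimal. *)
have d_eq1 : 4 / 7 <= c -> 8 - 28 * c <= 8 * d ^+ 2 - 28 * c * d.
  move=> hc.
  have : 0 <= (1 - d) * (28 * c - 8 - 8 * d) by apply: mulr_ge0; lra.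
  lra.
(* The unconstrained minimizers are [(7b - 3)/4] in [a] and [7c/4] in [d]. *)
have sqa := sqr_ge0 (a - (7 * b - 3) / 4).
have sqd := sqr_ge0 (d - 7 * c / 4).
have [hb|hb] := leP b (3 / 7) => /=.
  rewrite -ltNge => /ltW hc; have := d_eq1 hc.
  have : 0 <= a * (3 / 7 - b) by apply: mulr_ge0; lra.
  (* Completing the square in [25(b - c)^2 + 29(b - c)] leaves [c - 41/100], positive since
     [c >= 4/7]. *)
  have := sqr_ge0 (b - c + 29 / 50); have := sqr_ge0 a.
  lra.
move=> _; have [hc|/ltW hc] := leP c (4 / 7).
  (* Minimizing over [a] and [d] leaves [50b(1 - c) + (b^2 + c^2)/2 - 9/2], and
     [50 * 9/49 > 9/2]. *)
  have : (3 / 7) * (3 / 7) <= b * (1 - c) by apply: ler_pM; lra.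
  have := sqr_ge0 b; have := sqr_ge0 c.
  lra.
have := d_eq1 hc; have := sqr_ge0 b.
(* Putting 3/7 for [b] in [50b(1 - c)] leaves, with [t = 1 - c <= 3/7], the positive quantity
   [25t^2 - 4t/7 + 1/2 + b^2/2]. *)
have : 0 <= (1 - c) * (b - 3 / 7) by apply: mulr_ge0; lra.
have : 0 <= (1 - c) * (c - 4 / 7) by apply: mulr_ge0; lra.
have := sqr_ge0 (1 - c).
lra.
Qed.

Lemma qp_poly_ge0 : 0 <= qp_poly a b c d.
Proof.
have [/andP[hb hc]|/qp_poly_gt0/ltW//] := boolP ((b <= 3 / 7) && (c <= 4 / 7)).
apply: le_trans (qp_poly_ge_squares hb hc).
have := sqr_ge0 a; have := sqr_ge0 b; have := sqr_ge0 c.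
have := sqr_ge0 (d - 7 / 4 * c).
lra.
Qed.

(** A zero must lie where [b <= 3/7] and [c <= 4/7]. There all four squares vanish, and [c = 0] then
    yields [d = 0]. *)
Lemma qp_poly_eq0 : qp_poly a b c d = 0 -> [/\ a = 0, b = 0, c = 0 & d = 0].
Proof.
move=> q0.
have [/andP[hb hc]|/qp_poly_gt0] := boolP ((b <= 3 / 7) && (c <= 4 / 7));
  last by rewrite q0 ltxx.
have := qp_poly_ge_squares hb hc; rewrite q0 => sq_le0.
have sqa := sqr_ge0 a; have sqb := sqr_ge0 b; have sqc := sqr_ge0 c.
have sqd := sqr_ge0 (d - 7 / 4 * c).
have sq0 (t : R) : t ^+ 2 <= 0 -> t = 0.
  by move=> t0; apply/eqP; rewrite -sqrf_eq0 eq_le t0 sqr_ge0.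
have c0 : c = 0 by apply: sq0; lra.
split=> //; [by apply: sq0; lra|by apply: sq0; lra|].
have : d - 7 / 4 * c = 0 by apply: sq0; lra.
by rewrite c0; lra.
Qed.

End QpPoly.

Lemma qp_obj_Q4E (R : realType) (x : 'cV[R]_4) :
  qp_obj (Q4 R) (c4 R) x = qp_poly (x 0 0) (x 1 0) (x 2 0) (x 3 0).
Proof.
(* The indices take the form that [big_ord_recl] produces, so that [ring] identifies the entries of
   [x]. *)
have -> : 3 = lift ord0 (lift ord0 (lift ord0 ord0)) :> 'I_4 by exact: val_inj.
have -> : 2 = lift ord0 (lift ord0 ord0) :> 'I_4 by exact: val_inj.
have -> : 1 = lift ord0 ord0 :> 'I_4 by exact: val_inj.
rewrite /qp_obj /qp_poly !mxE !big_ord_recl !big_ord0 !mxE.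
rewrite !big_ord_recl !big_ord0 !mxE /=.
ring.
Qed.

(** * A rational feasible point of the relaxation *)

(** Each [x_i] is the largest entry of row [i] of [X], so [X <= x e^T] is tight in every row. *)
Definition sdp_point (R : realType) : 'cV[R]_4 * 'M[R]_4 :=
  (\col_i (nth 0 [:: 47; 96; 278; 368] i / 512),
   \matrix_(i, j) (nth 0 (nth [::]
    [:: [:: 47; 47;  47;  29];
        [:: 47; 62;  96;  96];
        [:: 47; 96; 225; 278];
        [:: 29; 96; 278; 368]] i) j / 512)).

Lemma sdp_point_obj (R : realType) :
  sdp_obj (Q4 R) (c4 R) (sdp_point R) = - (57 / 512).
Proof.
rewrite /sdp_obj /mxdot /mxtrace !big_ord_recl !big_ord0 !mxE.
rewrite !big_ord_recl !big_ord0 !mxE /=.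
lra.
Qed.

Lemma sdp_point_feasible (R : realType) : sdp_feasible (sdp_point R).
Proof.
apply/sdp_feasibleP; split.
- by move=> [[|[|[|[|i]]]] ?] [[|[|[|[|j]]]] ?] //; rewrite !mxE.
- by move=> [[|[|[|[|i]]]] ?] [[|[|[|[|j]]]] ?] //; rewrite !mxE /=; lra.
move=> v; rewrite -[v]vsubmxK tr_col_mx mul_row_block mul_row_col.
move: (usubmx v) (dsubmx v) => t u.
rewrite !mxE !big_ord_recl !big_ord0 !mxE !big_ord_recl !big_ord0 !mxE /=.
move: (t ord0 0) (u ord0 0) (u (lift ord0 ord0) 0) => t0 a b.
move: (u (lift ord0 (lift ord0 ord0)) 0) => c.
move: (u (lift ord0 (lift ord0 (lift ord0 ord0))) 0) => d.
(* Squares of the linear forms in the LDL factorization of the block matrix. *)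
have h1 := sqr_ge0 (t0 + 47 / 512 * a + 3 / 16 * b + 139 / 256 * c + 23 / 32 * d).
have h2 := sqr_ge0 (a + 416 / 465 * b + 78 / 155 * c - 816 / 7285 * d).
have h3 := sqr_ge0 (b + 5733 / 2287 * c + 7272 / 2287 * d).
have h4 := sqr_ge0 (c + 5004 / 3277 * d).
have h5 := sqr_ge0 d.
lra.
Qed.

(** * The two optimal values and the gap *)

Lemma qp_obj_ge0 (R : realType) (x : 'cV[R]_4) : unit_box x ->
  0 <= qp_obj (Q4 R) (c4 R) x.
Proof. by move=> xbox; rewrite qp_obj_Q4E; exact: qp_poly_ge0. Qed.

Lemma qp_obj_eq0 (R : realType) (x : 'cV[R]_4) : unit_box x ->
  qp_obj (Q4 R) (c4 R) x = 0 -> x = 0.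
Proof.
move=> xbox; rewrite qp_obj_Q4E => /qp_poly_eq0[]// x0 x1 x2 x3.
apply/colP => i; rewrite mxE.
case: i => [[|[|[|[|//]]]] ilt].
- by rewrite -x0; congr (x _ _); exact: val_inj.
- by rewrite -x1; congr (x _ _); exact: val_inj.
- by rewrite -x2; congr (x _ _); exact: val_inj.
- by rewrite -x3; congr (x _ _); exact: val_inj.
Qed.

Theorem proposition12 (R : realType) :
  exists v_qp v_sdp : R,
    [/\ optimal_value unit_box (qp_obj (Q4 R) (c4 R)) v_qp
          /\ v_qp = 0,
        forall x : 'cV[R]_4,
          minimizer unit_box (qp_obj (Q4 R) (c4 R)) x <-> x = 0,
        optimal_value sdp_feasible (sdp_obj (Q4 R) (c4 R)) v_sdp
          /\ v_sdp <= - (109 / 1024)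
      & 0 < v_qp - v_sdp].
Proof.
have box0 : unit_box (0 : 'cV[R]_4) by move=> i; rewrite mxE lexx ler01.
have obj0 : qp_obj (Q4 R) (c4 R) 0 = 0.
  by rewrite qp_obj_Q4E /qp_poly !mxE; ring.
have min0 : minimizer unit_box (qp_obj (Q4 R) (c4 R)) 0.
  by split=> // y /qp_obj_ge0; rewrite obj0.
have [v [z [zF zmin] zv]] := sdp_attained (Q4 R) (c4 R).
(* The rational point bounds the minimum, and [-57/512 = -114/1024] lies below [-109/1024]. *)
have vle : v <= - (57 / 512).
  by rewrite -zv -sdp_point_obj; exact: zmin (sdp_point_feasible R).
exists 0, v; split; first by split=> //; exists 0.
- move=> x; split=> [[xbox xmin]|-> //].
  apply: qp_obj_eq0 => //; apply: le_anti.
  by rewrite qp_obj_ge0 // -obj0 xmin.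
- by split; [exists z|lra].
- lra.
Qed.
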